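(* Let $x$ be a differentiable point of $f_\theta:\mathbb R^d\to\mathbb R^D$ such that $\mathcal B_r(x)\subseteq\Omega(x)$ for some $r>0$. If $d>D$, then there exists a $\delta\in\mathbb R^d$ such that for any $\hat x\in\mathbb R^d$ and $\bar\beta>0$, the following holds: $\|\delta\|_2=r$ and $$R(x,\hat x)<\bar\beta\implies R(x+\delta,\hat x)<\bar\beta .$$
   Context: Let $\theta$ be fixed and let $f_\theta:\mathbb R^d\to\mathbb R^D$ be a deep neural network with ReLU and/or max-pooling: $f_\theta(x)=\sigma^{[L]}\big(z^{[L]}(x,\theta)\big)$, $z^{[l]}(x,\theta)=W^{[l]}\sigma^{[l-1]}\big(z^{[l-1]}(x,\theta)\big)$ for $l=1,\dots,L$, where $\sigma^{[0]}(z^{[0]}(x,\theta))=x$, $\sigma^{[l]}$ is the nonlinear function due to ReLU and/or max-pooling, and $W^{[l]}\in\mathbb R^{N_l\times N_{l-1}}$ is the matrix of weight parameters connecting layer $l-1$ to layer $l$. For such $\sigma^{[l]}$ define $\dot\sigma^{[l]}(x,\theta)$ to be a diagonal matrix with each diagonal element $0$ or $1$ such that $\sigma^{[l]}(z^{[l]}(x,\theta))=\dot\sigma^{[l]}(x,\theta)\,z^{[l]}(x,\theta)$. For any differentiable point $x$ of $f_\theta$, define $\Omega(x)=\{x'\in\mathbb R^d:\forall l,\ \dot\sigma^{[l]}(x',\theta)=\dot\sigma^{[l]}(x,\theta)\}$ and $\mathcal B_r(x)=\{x'\in\mathbb R^d:\|x-x'\|_2\le r\}$. For $x,\hat x\in\mathbb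 R^d$, $R(x,\hat x)=\|f_\theta(x)-f_\theta(\hat x)\|_1$ is the $\ell_1$ distance between the encodings of $x$ and $\hat x$. *)

(* Defs.v *)
From HB Require Import structures.
From mathcomp Require Import all_boot all_order all_algebra.
From mathcomp Require Import all_classical all_reals all_analysis.
Import Order.TTheory GRing.Theory Num.Theory.
Import numFieldNormedType.Exports.

Set Implicit Arguments.
Unset Strict Implicit.
Unset Printing Implicit Defensive.

Local Open Scope classical_set_scope.
Local Open Scope ring_scope.

(* The library norm `|v| of a matrix is the sup norm,
   so the l1 and l2 norms are defined here. *)
Definition norm1 (R : realType) n (v : 'cV[R]_n) : R := \sum_i `|v i 0|.

Definition norm2 (R : realType) n (v : 'cV[R]_n) : R :=
  Num.sqrt (\sum_i v i 0 ^+ 2).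

Definition closed_ball2 (R : realType) n (x : 'cV[R]_n) (r : R) :
  set 'cV[R]_n := [set x' | norm2 (x - x') <= r].

Definition relu (R : realType) n (z : 'cV[R]_n) : 'cV[R]_n :=
  \col_i Num.max 0 (z i 0).

(* Max-pooling is a map from R^n to itself, so that it can be written as a 0/1
   diagonal matrix applied to its argument: in each block of a partition of the
   coordinates one maximal entry is kept and the others are set to 0 (the usual
   dimension-reducing max-pooling followed by a weight matrix is recovered by
   giving equal weight columns to the coordinates of a block). How ties are
   broken is left open, hence a predicate rather than a function. *)
Definition is_maxpool (R : realType) n (P : {set {set 'I_n}})
    (s : 'cV[R]_n -> 'cV[R]_n) : Prop :=
  forall (z : 'cV[R]_n) (B : {set 'I_n}), B \in P ->
    exists i : 'I_n,
      [/\ i \in B,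
          forall j, j \in B -> z j 0 <= z i 0,
          s z i 0 = z i 0
        & forall j, j \in B -> j != i -> s z j 0 = 0].

Inductive relu_maxpool (R : realType) n : ('cV[R]_n -> 'cV[R]_n) -> Prop :=
| RM_relu : relu_maxpool (@relu R n)
| RM_pool P s : finset.partition P [set: 'I_n]%SET -> is_maxpool P s ->
    relu_maxpool s
| RM_pool_relu P s : finset.partition P [set: 'I_n]%SET -> is_maxpool P s ->
    relu_maxpool (s \o @relu R n)
| RM_relu_pool P s : finset.partition P [set: 'I_n]%SET -> is_maxpool P s ->
    relu_maxpool (@relu R n \o s).

(* [weight l] and [nonlin l] stand for W^[l+1] and sigma^[l+1]; only the indices
   l < depth matter. *)
Record network (R : realType) := Network {
  depth : nat;
  width : nat -> nat;
  weight : forall l, 'M[R]_(width l.+1, width l);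
  nonlin : forall l, 'cV[R]_(width l.+1) -> 'cV[R]_(width l.+1);
  nonlinP : forall l, (l < depth)%N -> relu_maxpool (@nonlin l)
}.
Arguments weight {R} n l.
Arguments nonlin {R} n l.

Definition in_dim (R : realType) (net : network R) : nat := width net 0.
Definition out_dim (R : realType) (net : network R) : nat :=
  width net (depth net).

(* [act net l x] is sigma^[l](z^[l](x)), with sigma^[0](z^[0](x)) = x. *)
Fixpoint act (R : realType) (net : network R) (l : nat)
    (x : 'cV[R]_(in_dim net)) : 'cV[R]_(width net l) :=
  match l return 'cV[R]_(width net l) with
  | 0%N => x
  | l'.+1 => nonlin net l' (weight net l' *m act l' x)
  end.

(* z^[l+1](x) *)
Definition preact (R : realType) (net : network R) (l : nat)
    (x : 'cV[R]_(in_dim net)) : 'cV[R]_(width net l.+1) :=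
  weight net l *m act l x.

Definition encoder (R : realType) (net : network R)
    (x : 'cV[R]_(in_dim net)) : 'cV[R]_(out_dim net) := act (depth net) x.
Arguments encoder {R} net x.

(* [sdot l x] stands for the matrix sigma-dot^[l+1](x). The defining equation
   does not determine it at the coordinates where z^[l+1](x) vanishes: any
   choice is allowed. *)
Definition is_sigma_dot (R : realType) (net : network R)
    (sdot : forall l, 'cV[R]_(in_dim net) -> 'M[R]_(width net l.+1)) : Prop :=
  forall l (x : 'cV[R]_(in_dim net)), (l < depth net)%N ->
    [/\ is_diag_mx (sdot l x),
        forall i, sdot l x i i = 0 \/ sdot l x i i = 1
      & nonlin net l (preact l x) = sdot l x *m preact l x].

Definition Omega (R : realType) (net : network R)
    (sdot : forall l, 'cV[R]_(in_dim net) -> 'M[R]_(width net l.+1))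
    (x : 'cV[R]_(in_dim net)) : set 'cV[R]_(in_dim net) :=
  [set x' | forall l, (l < depth net)%N -> sdot l x' = sdot l x].

Definition code_dist (R : realType) (net : network R)
    (x xhat : 'cV[R]_(in_dim net)) : R :=
  norm1 (encoder net x - encoder net xhat).

(* Main.v *)
Require Import Defs.
From HB Require Import structures.
From mathcomp Require Import all_boot all_order all_algebra.
From mathcomp Require Import all_classical all_reals all_analysis.
Import Order.TTheory GRing.Theory Num.Theory.
Import numFieldNormedType.Exports.
Local Open Scope classical_set_scope.
Local Open Scope ring_scope.

(** On [Omega sdot x] every nonlinearity acts as one fixed matrix, so the encoder
    is linear there. Since [D < d] this linear map has a nonzero kernel vector;
    scaled to norm [r], it moves [x] inside the ball without changing its code. *)

Lemma norm2_gt0 (R : realType) n (v : 'cV[R]_n) : v != 0 -> 0 < norm2 v.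
Proof.
move=> v_neq0; rewrite sqrtr_gt0 lt0r sumr_ge0 ?andbT => [|i _]; last first.
  exact: sqr_ge0.
apply: contra v_neq0; rewrite psumr_eq0 => [/allP v0|i _]; last exact: sqr_ge0.
apply/eqP/colP => i; rewrite mxE; apply/eqP.
by have := v0 i (mem_index_enum i); rewrite sqrf_eq0.
Qed.

Lemma norm2Z (R : realType) n (a : R) (v : 'cV[R]_n) :
  norm2 (a *: v) = `|a| * norm2 v.
Proof.
rewrite /norm2 -sqrtr_sqr -sqrtrM ?sqr_ge0// mulr_sumr.
by congr Num.sqrt; apply: eq_bigr => i _; rewrite mxE exprMn.
Qed.

Lemma norm2N (R : realType) n (v : 'cV[R]_n) : norm2 (- v) = norm2 v.
Proof. by rewrite -scaleN1r norm2Z normrN1 mul1r. Qed.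

(** [kermx] is a left kernel, so the argument runs on [A^T]: it has [n] rows but rank at most
    [m < n], hence some nonzero row [u] satisfies [u *m A^T = 0]. *)
Lemma wide_mx_ker (F : fieldType) m n (A : 'M[F]_(m, n)) :
  (m < n)%N -> exists2 v : 'cV[F]_n, v != 0 & A *m v = 0.
Proof.
move=> lt_mn; have: kermx A^T != 0.
  rewrite kermx_eq0 /row_free neq_ltn mxrank_tr.
  by rewrite (leq_ltn_trans (rank_leq_row A)).
case/rowV0Pn => u /sub_kermxP uA0 u_neq0; exists u^T; first by rewrite trmx_eq0.
by apply: trmx_inj; rewrite trmx_mul trmxK uA0 trmx0.
Qed.

(** By induction on the layer, [M] is the product of the weights and of the matrices [sdot] taken at
    [x]; it is chosen before [y], so one matrix serves all of [Omega sdot x]. *)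
Lemma act_linear_on_Omega (R : realType) (net : network R)
    (sdot : forall l, 'cV[R]_(in_dim net) -> 'M[R]_(width net l.+1))
    (x : 'cV[R]_(in_dim net)) l :
  is_sigma_dot sdot -> (l <= depth net)%N ->
  exists M : 'M[R]_(width net l, in_dim net),
    forall y, Omega sdot x y -> act l y = M *m y.
Proof.
move=> sdotP; elim: l => [_|l IHl lt_l].
  by exists 1%:M => y _; rewrite mul1mx.
have [M actM] := IHl (ltnW lt_l).
exists (sdot l x *m (weight net l *m M)) => y Oy.
have [_ _ nonlinE] := sdotP l y lt_l.
(* Trading [sdot l x] for [sdot l y] leaves [nonlinE], up to unfolding [act] and [preact]. *)
by rewrite -!mulmxA -actM// -(Oy l lt_l).
Qed.

Theorem proposition6p2 (R : realType) (net : network R)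
  (sdot : forall l, 'cV[R]_(in_dim net) -> 'M[R]_(width net l.+1))
  (sdotP : is_sigma_dot sdot)
  (x : 'cV[R]_(in_dim net)) (r : R)
  (x_diff : differentiable (encoder net) x)
  (r_gt0 : 0 < r)
  (ball_sub : closed_ball2 x r `<=` Omega sdot x)
  (dims : (out_dim net < in_dim net)%N) :
  exists delta : 'cV[R]_(in_dim net),
    forall (xhat : 'cV[R]_(in_dim net)) (beta : R), 0 < beta ->
      norm2 delta = r /\
      (code_dist x xhat < beta -> code_dist (x + delta) xhat < beta).
Proof.
have [M encM] := act_linear_on_Omega _ _ _ x _ sdotP (leqnn _).
have [v v_neq0 Mv0] := wide_mx_ker _ _ _ M dims.
have v_gt0 := norm2_gt0 _ _ _ v_neq0.
(* [delta] is fixed before [xhat] and [beta]. *)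
pose delta := (r / norm2 v) *: v; exists delta => xhat beta _.
have delta_r : norm2 delta = r.
  by rewrite norm2Z ger0_norm ?divr_ge0 ?ltW// divfK ?gt_eqF.
split=> //; rewrite /code_dist;
  suff -> : encoder net (x + delta) = encoder net x by [].
(* The ball is closed, so a displacement of norm exactly [r] stays in it. *)
have Oxd : Omega sdot x (x + delta).
  by apply: ball_sub; rewrite /closed_ball2/= opprD addNKr norm2N delta_r.
(* [encM] applies at [x + delta] by [Oxd], and at [x] since [x] lies trivially in its own
   [Omega]. *)
by rewrite /encoder !encM// mulmxDr -scalemxAr Mv0 scaler0 addr0.
Qed.
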